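(* Let $n\ge 1$. There is a bijection $\Phi_n$ from the set $\mathrm{R2}\delta_n$ of rook placements on the double staircase $2\delta_n$ to the set $\mathcal{T}_{n+1}$ of increasing binary trees with vertex set $\{1,\ldots,n+1\}$ such that, for every $R\in\mathrm{R2}\delta_n$ and every $i\in\{1,\ldots,n\}$, the following hold: - the $i$-th block of $R$ has a rook in both of its columns if and only if vertex $i$ of $\Phi_n(R)$ has two children; - the $i$-th block of $R$ has no rook in either column if and only if vertex $i$ of $\Phi_n(R)$ has no children; - the $i$-th block of $R$ has a rook in its left column but none in its right column if and only if vertex $i$ of $\Phi_n(R)$ has a left child but no right child; - the $i$-th block of $R$ has a rook in its right column but none in its left column if and only if vertex $i$ of $\Phi_n(R)$ has a right child but no left child.
   Context: The double staircase $2\delta_n$ is the Young diagram, in French notation, of the partition $(2n,2(n-1),\ldots,2)$. Its rows are numbered $1,\ldots,n$ from top to bottom, so that row $j$ has $2j$ cells, and its columns are numbered $1,\ldots,2n$ from left to right. A block of a Young diagram is a maximal collection of columns of the same height. For $2\delta_n$, the blocks are the pairs of columns $\{2i-1,2i\}$ for $i=1,\ldots,n$, and they are indexed from left to right. The $i$-th block has height $n-i+1$ and occupies rows $i,\ldots,n$. A rook placement on $2\delta_n$ is a placement of $n$ rooks in cells of $2\delta_n$ with exactly one rook in each row and at most one rook in each column; $\mathrm{R2}\delta_n$ denotes the set of these placements. An increasing binary tree on $m$ vertices is a rooted tree whose vertices carry distinct labels from $\{1,\ldots,m\}$, in which each vertex has at most one left child and at most one right child, and in which every child has a larger label than its parent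 (so the root is $1$). $\mathcal{T}_m$ denotes the set of these trees. *)

(* Defs.v *)
From mathcomp Require Import all_boot.

Set Implicit Arguments.
Unset Strict Implicit.
Unset Printing Implicit Defensive.

(* Ordinals are 0-based: a pair (r, c) stands for the cell in row r + 1 (from
   the top) and column c + 1 (from the left) of the bounding n x 2n rectangle.
   Row and column numbers below, obtained with row_num and col_num, are
   1-based. *)
Notation cell n := ('I_n * 'I_(2 * n))%type.

Definition row_num n (p : cell n) : nat := p.1.+1.
Definition col_num n (p : cell n) : nat := p.2.+1.

Definition double_staircase (n : nat) : {set cell n} :=
  [set p | col_num p <= 2 * row_num p].

(* One rook in each of the n rows forces the total number of rooks to be n. *)
Definition is_rook_placement n (R : {set cell n}) : bool :=
  [&& R \subset double_staircase n,
      [forall r : 'I_n, #|[set p in R | p.1 == r]| == 1]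
    & [forall c : 'I_(2 * n), #|[set p in R | p.2 == c]| <= 1]].

Definition R2delta (n : nat) : Type :=
  {R : {set cell n} | is_rook_placement R}.

Definition rook_in_column n (R : R2delta n) (c : nat) : bool :=
  [exists p in val R, col_num p == c].

(* The i-th block consists of the columns 2i - 1 and 2i, for 1 <= i <= n. *)
Definition rook_in_left_column n (R : R2delta n) (i : nat) : bool :=
  rook_in_column R (2 * i - 1).
Definition rook_in_right_column n (R : R2delta n) (i : nat) : bool :=
  rook_in_column R (2 * i).

(* Empty encodes an absent child. *)
Inductive bintree : Type :=
  | Empty
  | Node of bintree & nat & bintree.

Definition nonempty (t : bintree) : bool :=
  if t is Node _ _ _ then true else false.

Fixpoint labels (t : bintree) : seq nat :=
  if t is Node l x r then x :: labels l ++ labels r else [::].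

Definition root_gt (x : nat) (t : bintree) : bool :=
  if t is Node _ y _ then x < y else true.

Fixpoint increasing (t : bintree) : bool :=
  if t is Node l x r
  then [&& root_gt x l, root_gt x r, increasing l & increasing r]
  else true.

Definition is_incr_bintree (m : nat) (t : bintree) : bool :=
  increasing t && perm_eq (labels t) (iota 1 m).

Definition incr_bintree (m : nat) : Type :=
  {t : bintree | is_incr_bintree m t}.

Fixpoint left_child_in (t : bintree) (i : nat) : bool :=
  if t is Node l x r
  then [|| (x == i) && nonempty l, left_child_in l i | left_child_in r i]
  else false.

Fixpoint right_child_in (t : bintree) (i : nat) : bool :=
  if t is Node l x r
  then [|| (x == i) && nonempty r, right_child_in l i | right_child_in r i]
  else false.

Definition has_left_child m (t : incr_bintree m) (i : nat) : bool :=
  left_child_in (val t) i.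
Definition has_right_child m (t : incr_bintree m) (i : nat) : bool :=
  right_child_in (val t) i.

(* Main.v *)
Require Import Defs.
From mathcomp Require Import all_boot.
From mathcomp Require Import zify.

(** Call [2 i - 1] and [2 i] the slots for a left and a right child of vertex
    [i]. An increasing tree on [n + 1] vertices arises in exactly one way by
    attaching the vertices [2, ..., n + 1] in this order, each at a free slot;
    vertex [j + 1] may use the slots [1, ..., 2 j], which are the columns
    available to the rook of row [j]. The bijection sends a placement whose
    rook in row [j] is in column [c_j] to the tree in which vertex [j + 1]
    hangs at slot [c_j]. *)

Set Implicit Arguments.
Unset Strict Implicit.
Unset Printing Implicit Defensive.

(** * Edges and free slots of a binary tree *)

(* Pairs (slot, vertex at that slot), where the root hangs at slot [p]. *)
Fixpoint edges (p : nat) (t : bintree) : seq (nat * nat) :=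
  if t is Node l y r
  then (p, y) :: edges (2 * y - 1) l ++ edges (2 * y) r else [::].

Fixpoint free_slots (p : nat) (t : bintree) : seq nat :=
  if t is Node l y r
  then free_slots (2 * y - 1) l ++ free_slots (2 * y) r else [:: p].

(** [edges] and [labels] traverse the tree in the same order, so the index of [x] among the labels
    locates its edge. A missing label gets the default slot 0. *)
Definition slot_of (t : bintree) (x : nat) : nat :=
  nth 0 (unzip1 (edges 0 t)) (index x (labels t)).

Lemma unzip2_edges p t : unzip2 (edges p t) = labels t.
Proof.
elim: t p => [|l IHl y r IHr] p //=.
by rewrite /unzip2 map_cat -/(unzip2 _) -/(unzip2 _) IHl IHr.
Qed.

Lemma nth_index_unzip (s : seq (nat * nat)) e :
  uniq (unzip2 s) -> e \in s -> nth 0 (unzip1 s) (index e.2 (unzip2 s)) = e.1.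
Proof.
elim: s => //= a s IHs /andP [anotin us]; rewrite inE => /orP [/eqP ->|es].
  by rewrite eqxx.
case: eqP => [ea|_]; last exact: IHs.
by move/negP: anotin; case; rewrite ea; apply: map_f.
Qed.

Lemma slot_of_edge t e :
  uniq (labels t) -> e \in edges 0 t -> slot_of t e.2 = e.1.
Proof.
move=> ut et; rewrite /slot_of -(unzip2_edges 0).
by apply: nth_index_unzip; rewrite ?unzip2_edges.
Qed.

Lemma edge_slot_of t x :
  uniq (labels t) -> x \in labels t -> (slot_of t x, x) \in edges 0 t.
Proof.
move=> ut; rewrite -(unzip2_edges 0) => /mapP [e et ->].
by rewrite slot_of_edge //; case: e et.
Qed.

(** Each vertex occupies one slot and opens two new ones. The equality is one of multisets, so it
    needs no distinctness of labels. *)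
Lemma perm_slots p t :
  perm_eq (unzip1 (edges p t) ++ free_slots p t)
          (p :: flatten [seq [:: 2 * y - 1; 2 * y] | y <- labels t]).
Proof.
elim: t p => [|l IHl y r IHr] p //=.
rewrite perm_cons map_cat flatten_cat /unzip1 map_cat.
rewrite -/(unzip1 _) -/(unzip1 _).
apply/permP => a; rewrite /= !count_cat.
move/permP/(_ a): (IHl (2 * y - 1)); move/permP/(_ a): (IHr (2 * y)).
by rewrite /= !count_cat /=; lia.
Qed.

Lemma flatten_slots_iota k m :
  flatten [seq [:: 2 * y - 1; 2 * y] | y <- iota k.+1 m]
  = iota (2 * k).+1 (2 * m).
Proof.
elim: m k => [|m IHm] k //.
have -> : 2 * m.+1 = (2 * m).+2 by lia.
rewrite [LHS]/= IHm.
have -> : 2 * k.+1 - 1 = (2 * k).+1 by lia.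
by have -> : 2 * k.+1 = (2 * k).+2 by lia.
Qed.

Lemma perm_slots_iota m t :
  perm_eq (labels t) (iota 1 m) ->
  perm_eq (unzip1 (edges 0 t) ++ free_slots 0 t) (iota 0 (2 * m).+1).
Proof.
move=> tm; apply: (perm_trans (perm_slots 0 t)).
rewrite /= perm_cons -(flatten_slots_iota 0 m).
by apply: perm_flatten; apply: perm_map.
Qed.

Lemma uniq_slots m t :
  perm_eq (labels t) (iota 1 m) ->
  uniq (unzip1 (edges 0 t) ++ free_slots 0 t).
Proof. by move/perm_slots_iota/perm_uniq ->; apply: iota_uniq. Qed.

Lemma uniq_edge_slot p t e e' :
  uniq (unzip1 (edges p t)) -> e \in edges p t -> e' \in edges p t ->
  e.1 = e'.1 -> e = e'.
Proof.
elim: (edges p t) => //= a s IHs /andP [anotin us].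
rewrite !inE => /orP [/eqP ->|es] /orP [/eqP ->|es'] // ee.
- by case/negP: anotin; rewrite ee; apply: map_f.
- by case/negP: anotin; rewrite -ee; apply: map_f.
- exact: IHs.
Qed.

(** Left slots of positive vertices are odd and right slots are even. For [i = 0] truncated
    subtraction would make both equal to 0. *)
Lemma left_child_in_slot p t i : 0 < i ->
  (2 * i - 1 \in unzip1 (edges p t))
  = (2 * i - 1 == p) && nonempty t || left_child_in t i.
Proof.
move=> i0; elim: t p => [|l IHl y r IHr] p; first by rewrite andbF.
rewrite /= inE /unzip1 map_cat mem_cat -/(unzip1 _) -/(unzip1 _) IHl IHr.
have -> : (2 * i - 1 == 2 * y) = false by lia.
have -> : (2 * i - 1 == 2 * y - 1) = (y == i) by lia.
by rewrite andbT /= -!orbA.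
Qed.

Lemma right_child_in_slot p t i : 0 < i ->
  (2 * i \in unzip1 (edges p t))
  = (2 * i == p) && nonempty t || right_child_in t i.
Proof.
move=> i0; elim: t p => [|l IHl y r IHr] p; first by rewrite andbF.
rewrite /= inE /unzip1 map_cat mem_cat -/(unzip1 _) -/(unzip1 _) IHl IHr.
have -> : (2 * i == 2 * y - 1) = false by lia.
have -> : (2 * i == 2 * y) = (y == i) by lia.
by rewrite andbT /=; case: (_ == p); case: (_ && _) => //=; rewrite ?orbT.
Qed.

Lemma root_gt_increasing y t :
  root_gt y t -> increasing t -> all (fun z => y < z) (labels t).
Proof.
elim: t y => [|l IHl x r IHr] y //= yx /and4P [xl xr il ir].
rewrite yx all_cat /=; apply/andP; split; apply/allP => z.
  by move/(allP (IHl _ xl il)) => /=; lia.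
by move/(allP (IHr _ xr ir)) => /=; lia.
Qed.

(** A vertex not at the root hangs from a parent [y] with a smaller label, at slot [2 * y - 1] or
    [2 * y]. This becomes the staircase condition on columns. *)
Lemma edge_slot_le p t e :
  increasing t -> e \in edges p t -> e.1 = p \/ e.1 <= 2 * e.2.-1.
Proof.
elim: t p => [|l IHl y r IHr] p //= /and4P [yl yr il ir].
rewrite inE mem_cat => /orP [/eqP ->|/orP [el|er]]; [by left|right|right].
  have := allP (root_gt_increasing yl il) e.2.
  rewrite -(unzip2_edges (2 * y - 1)) => /(_ (map_f _ el)).
  by case: (IHl _ il el) => /=; lia.
have := allP (root_gt_increasing yr ir) e.2.
rewrite -(unzip2_edges (2 * y)) => /(_ (map_f _ er)).
by case: (IHr _ ir er) => /=; lia.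
Qed.

(** * Attaching and detaching a leaf *)

Fixpoint attach (c x p : nat) (t : bintree) : bintree :=
  if t is Node l y r
  then Node (attach c x (2 * y - 1) l) y (attach c x (2 * y) r)
  else if p == c then Node Empty x Empty else Empty.

(** The whole subtree at [x] is cut off; when [x] is the largest label of an increasing tree, that
    subtree is a single leaf. *)
Fixpoint detach (x : nat) (t : bintree) : bintree :=
  if t is Node l y r
  then if y == x then Empty else Node (detach x l) y (detach x r)
  else Empty.

(** [attach] fills every free position whose slot is [c], hence the multiplicity; it is 1 once [c]
    is known to be free and slots are distinct. *)
Lemma edges_attach c x p t :
  perm_eq (edges p (attach c x p t))
          (nseq (count_mem c (free_slots p t)) (c, x) ++ edges p t).
Proof.
elim: t p => [|l IHl y r IHr] p /=; first by case: eqP => [->|].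
apply/permP => a; rewrite /= count_cat /= !count_cat count_nseq.
move/permP/(_ a): (IHl (2 * y - 1)); move/permP/(_ a): (IHr (2 * y)).
rewrite /= !count_cat !count_nseq mulnDr => -> ->.
by move: (a (c, x) * _) => u; move: (a (c, x) * _) => v; lia.
Qed.

Lemma increasing_attach c x p t :
  all (fun z => z < x) (labels t) -> increasing t ->
  increasing (attach c x p t).
Proof.
have root_gt_attach y q u :
    y < x -> root_gt y u -> root_gt y (attach c x q u).
  by case: u => //= yx _; case: ifP.
elim: t p => [|l IHl y r IHr] p /=; first by case: ifP.
rewrite all_cat => /and3P [yx al ar] /and4P [yl yr il ir].
by rewrite !root_gt_attach // IHl // IHr.
Qed.

Lemma leaf_of_max_label x l r :
  all (fun z => z <= x) (labels l ++ labels r) ->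
  increasing (Node l x r) -> l = Empty /\ r = Empty.
Proof.
rewrite all_cat => /andP [al ar] /= /and4P [xl xr _ _].
case: l al xl => [|? z ?] /=; last by case/andP; lia.
by case: r ar xr => [|? z ?] //=; case/andP; lia.
Qed.

Lemma edges_detach x p t :
  all (fun z => z <= x) (labels t) -> increasing t ->
  edges p (detach x t) = [seq e <- edges p t | e.2 != x].
Proof.
elim: t p => [|l IHl y r IHr] p //=.
case: eqP => [->|yx] /andP [_ a] i; first by case: (leaf_of_max_label a i) => -> ->.
move: a i; rewrite all_cat => /andP [al ar] /and4P [_ _ il ir] /=.
by rewrite filter_cat IHl // IHr.
Qed.

Lemma increasing_detach x t : increasing t -> increasing (detach x t).
Proof.
have root_gt_detach y u : root_gt y u -> root_gt y (detach x u).
  by case: u => //= l z r yz; case: ifP.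
elim: t => [|l IHl y r IHr] //= /and4P [yl yr il ir].
by case: ifP => //= _; rewrite !root_gt_detach // IHl // IHr.
Qed.

(** The third hypothesis says that exactly the edges into [x] lie at slot [c], so detaching reopens
    [c] there, and by the last hypothesis [c] is free nowhere else. *)
Lemma attach_detach c x p t :
  all (fun z => z <= x) (labels t) -> increasing t ->
  (forall e, e \in edges p t -> (e.2 == x) = (e.1 == c)) ->
  c \notin free_slots p t ->
  attach c x p (detach x t) = t.
Proof.
elim: t p => [|l IHl y r IHr] p /=.
  by rewrite inE eq_sym => _ _ _ /negbTE ->.
case/andP=> yx a i Ht; rewrite mem_cat negb_or => /andP [cl cr].
have := Ht (p, y); rewrite inE eqxx /= => /(_ isT) yp.
case: eqP yp => [yEx|_ _].
  move=> yp; move: a i; rewrite yEx => a i.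
  by case: (leaf_of_max_label a i) => -> -> /=; rewrite -yp.
move: a i; rewrite all_cat /= => /andP [al ar] /and4P [_ _ il ir].
rewrite IHl ?IHr // => e eE; apply: Ht; by rewrite inE mem_cat eE ?orbT.
Qed.

(** * Trees built from slot functions *)

(* [f r] is the slot of vertex [r + 2], i.e. the column of the rook in the row
   with 0-based index [r]. *)
Definition slot_function (n : nat) (f : nat -> nat) : Prop :=
  (forall r, r < n -> 0 < f r <= 2 * r.+1) /\
  (forall r s, r < n -> s < n -> f r = f s -> r = s).

Fixpoint tree_of (f : nat -> nat) (n : nat) : bintree :=
  if n is m.+1 then attach (f m) m.+2 0 (tree_of f m)
  else Node Empty 1 Empty.

Lemma slot_functionW n f : slot_function n.+1 f -> slot_function n f.
Proof.
case=> fb fi; split=> [r rn|r s rn sn]; first by apply: fb; lia.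
by apply: fi; lia.
Qed.

Lemma eq_tree_of n f g :
  (forall r, r < n -> f r = g r) -> tree_of f n = tree_of g n.
Proof.
elim: n => //= n IHn fg; rewrite fg // IHn // => r rn.
by apply: fg; lia.
Qed.

Lemma perm_labels_of_edges n f t :
  perm_eq (edges 0 t) ((0, 1) :: [seq (f r, r.+2) | r <- iota 0 n]) ->
  perm_eq (labels t) (iota 1 n.+1).
Proof.
move/(perm_map snd); rewrite -/(unzip2 _) unzip2_edges /= -map_comp => tE.
apply: perm_trans tE _; rewrite perm_cons.
by rewrite (iotaDl 2 0) (@eq_map _ _ _ (addn 2)).
Qed.

Lemma edges_tree_of n f : slot_function n f ->
  perm_eq (edges 0 (tree_of f n))
          ((0, 1) :: [seq (f r, r.+2) | r <- iota 0 n]).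
Proof.
elim: n => [|n IHn] // fs.
have E := IHn (slot_functionW fs); case: fs => fb fi.
have slots := perm_slots_iota (perm_labels_of_edges E).
have us := uniq_slots (perm_labels_of_edges E).
apply: perm_trans (edges_attach _ _ _ _) _.
(* The slot [f n] exists by its upper bound. It is not occupied: it differs from the root slot 0 by
   positivity and from the earlier [f r] by injectivity. Hence it is free, exactly once. *)
have -> : count_mem (f n) (free_slots 0 (tree_of f n)) = 1.
  have fn_used : f n \notin unzip1 (edges 0 (tree_of f n)).
    rewrite (perm_mem (perm_map fst E)) /= inE negb_or.
    apply/andP; split; first by have := fb n (ltnSn n); lia.
    rewrite -map_comp; apply/mapP => -[r]; rewrite mem_iota /= => rn.
    by move/fi; lia.
  rewrite count_uniq_mem; last by move: us; rewrite cat_uniq => /and3P [].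
  have : f n \in iota 0 (2 * n.+1).+1.
    by rewrite mem_iota; have := fb n (ltnSn n); lia.
  by rewrite -(perm_mem slots) mem_cat (negbTE fn_used) /= => ->.
have -> : iota 0 n.+1 = iota 0 n ++ [:: n] by rewrite -addn1 iotaD.
rewrite map_cat -cat_cons cats1 perm_sym.
by rewrite perm_rcons /= perm_cons perm_sym.
Qed.

Lemma perm_labels_tree_of n f : slot_function n f ->
  perm_eq (labels (tree_of f n)) (iota 1 n.+1).
Proof. by move/edges_tree_of/perm_labels_of_edges. Qed.

Lemma is_incr_bintree_tree_of n f : slot_function n f ->
  is_incr_bintree n.+1 (tree_of f n).
Proof.
move=> fs; rewrite /is_incr_bintree perm_labels_tree_of // andbT.
elim: n fs => [|n IHn] // fs; have fs' := slot_functionW fs.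
apply: increasing_attach; last exact: IHn.
apply/allP => z; rewrite (perm_mem (perm_labels_tree_of fs')) mem_iota; lia.
Qed.

Lemma slot_of_tree_of n f r : slot_function n f -> r < n ->
  slot_of (tree_of f n) r.+2 = f r.
Proof.
move=> fs rn; apply: (@slot_of_edge _ (f r, r.+2)).
  by rewrite (perm_uniq (perm_labels_tree_of fs)) iota_uniq.
rewrite (perm_mem (edges_tree_of fs)) inE; apply/orP; right.
by apply/mapP; exists r => //; rewrite mem_iota.
Qed.

Lemma slot_function_slot_of n t : is_incr_bintree n.+1 t ->
  slot_function n (fun r => slot_of t r.+2).
Proof.
case/andP=> it tn.
have ut : uniq (labels t) by rewrite (perm_uniq tn) iota_uniq.
have us : uniq (unzip1 (edges 0 t)).
  by have := uniq_slots tn; rewrite cat_uniq => /and3P [].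
have edge r : r < n -> (slot_of t r.+2, r.+2) \in edges 0 t.
  by move=> rn; apply: edge_slot_of; rewrite // (perm_mem tn) mem_iota; lia.
split=> [r rn|r s rn sn rs]; last first.
  by case: (uniq_edge_slot us (edge r rn) (edge s sn) rs).
have /= := edge_slot_le it (edge r rn).
(* Only the root hangs at slot 0, and its label is 1, so vertex [r.+2] cannot be there. *)
case: (posnP (slot_of t r.+2)) => [r0 _|]; last by lia.
have := edge r rn; rewrite r0.
have l1 : 1 \in labels t by rewrite (perm_mem tn) mem_iota.
have pos : all (leq 1) (labels t).
  by apply/allP => z; rewrite (perm_mem tn) mem_iota; lia.
case: t l1 pos it us {tn ut edge r0} => //= l y r' l1 /andP [y0 _] it us.
have y1 : y <= 1.
  (* Taking [y.-1] as strict lower bound makes it apply to the root [y] as well as to its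
     descendants. *)
  have gt : root_gt y.-1 (Node l y r') by rewrite /=; lia.
  by have := allP (root_gt_increasing gt it) 1 l1; lia.
move=> re; have := @uniq_edge_slot 0 (Node l y r') _ (0, y) us re.
by rewrite /= inE eqxx => /(_ isT erefl) [ry]; lia.
Qed.

(** Induction on [n]: the largest vertex is a leaf, removing it leaves all other slots unchanged,
    and attaching it again at its old slot restores [t]. *)
Lemma tree_of_slot_of n t : is_incr_bintree n.+1 t ->
  tree_of (fun r => slot_of t r.+2) n = t.
Proof.
elim: n t => [|n IHn] t /andP [it tn] /=.
  have := perm_size tn; have := perm_mem tn 1; case: t {it tn} => //= l y r.
  case: l => [|? ? ?] /=; last by [].
  by case: r => [|? ? ?] //=; rewrite !inE => /eqP <-.
have ut : uniq (labels t) by rewrite (perm_uniq tn) iota_uniq.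
have us := uniq_slots tn.
have max : all (fun z => z <= n.+2) (labels t).
  by apply/allP => z; rewrite (perm_mem tn) mem_iota; lia.
have et := edges_detach 0 max it.
have lt : labels (detach n.+2 t) = [seq y <- labels t | y != n.+2].
  by rewrite -!(unzip2_edges 0) et /unzip2 filter_map.
have dn : is_incr_bintree n.+1 (detach n.+2 t).
  rewrite /is_incr_bintree increasing_detach //= lt.
  apply: perm_trans (perm_filter _ tn) _.
  have -> : iota 1 n.+2 = iota 1 n.+1 ++ [:: n.+2].
    by have := iotaD 1 n.+1 1; rewrite addn1 add1n.
  rewrite filter_cat [X in _ ++ X]/= eqxx cats0 (all_filterP _) //.
  by apply/allP => z; rewrite mem_iota; lia.
have ud : uniq (labels (detach n.+2 t)) by rewrite lt filter_uniq.
rewrite (@eq_tree_of _ _ (fun r => slot_of (detach n.+2 t) r.+2)); last first.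
  move=> r rn; have rd : r.+2 \in labels (detach n.+2 t).
    by rewrite lt mem_filter (perm_mem tn) mem_iota; lia.
  have := edge_slot_of ud rd; rewrite et mem_filter => /andP [_].
  by move/(slot_of_edge ut).
rewrite IHn //.
have xe : (slot_of t n.+2, n.+2) \in edges 0 t.
  by apply: edge_slot_of; rewrite // (perm_mem tn) mem_iota; lia.
move: us; rewrite cat_uniq => /and3P [us /hasPn disj _].
apply: attach_detach => // [e ee|].
  apply/eqP/eqP => [ex|ec]; first by rewrite -ex slot_of_edge.
  by rewrite (uniq_edge_slot us ee xe ec).
apply/negP => /disj; rewrite /= => /negP; apply.
by apply/mapP; exists (slot_of t n.+2, n.+2).
Qed.

(** * Rook placements as slot functions *)

(** The default 0 is never a column number, since columns are counted from 1. *)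
Definition rook_column n (R : {set cell n}) (r : nat) : nat :=
  if [pick p in R | p.1 == r :> nat] is Some p then col_num p else 0.

Definition placement n (f : nat -> nat) : {set cell n} :=
  [set p | col_num p == f p.1].

Lemma mem_rook_placement n (R : {set cell n}) p : is_rook_placement R ->
  (p \in R) = (col_num p == rook_column R p.1).
Proof.
case/and3P=> _ /forallP rows _; have /cards1P [q rowE] := rows p.1.
have inrow z : (z \in R) && (z.1 == p.1) = (z == q).
  by have := in_set1 z q; rewrite -rowE inE.
rewrite /rook_column; case: pickP => [z /andP [zR zp]|noz].
  have /eqP zq : z == q by rewrite -inrow zR.
  have := inrow p; rewrite eqxx andbT => ->; subst z.
  apply/eqP/eqP => [-> //|[cE]].
  case: p q zp cE {rows rowE inrow zR} => [r c] [r' c'] /= /eqP /val_inj -> cE.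
  by congr (_, _); apply: val_inj.
have := inrow q; rewrite eqxx => /andP [qR /eqP qp].
by have := noz q; rewrite /= qR qp eqxx.
Qed.

Lemma rook_in_row n (R : {set cell n}) r : is_rook_placement R -> r < n ->
  exists2 p, p \in R & p.1 = r :> nat /\ col_num p = rook_column R r.
Proof.
move=> RP rn; have /and3P [_ /forallP rows _] := RP.
have /cards1P [q rowE] := rows (Ordinal rn).
have : q \in [set p in R | p.1 == Ordinal rn] by rewrite rowE in_set1.
rewrite inE => /andP [qR /eqP q1]; exists q => //; rewrite q1; split=> //.
by move: qR; rewrite (mem_rook_placement _ RP) q1 => /eqP.
Qed.

(** The staircase shape gives the bounds, and the limit of one rook per column gives injectivity. *)
Lemma slot_function_rook_column n (R : {set cell n}) :
  is_rook_placement R -> slot_function n (rook_column R).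
Proof.
move=> RP; have /and3P [/subsetP sub _ /forallP cols] := RP.
split=> [r rn|r s rn sn].
  have [p pR [p1 <-]] := rook_in_row RP rn.
  by have := sub p pR; rewrite inE /row_num p1.
have [p pR [<- <-]] := rook_in_row RP rn.
have [q qR [<- <-]] := rook_in_row RP sn => -[/val_inj pq].
have /card_le1_eqP /(_ p q) := cols p.2.
by rewrite !inE pR qR pq eqxx => -> .
Qed.

Lemma is_rook_placement_placement n f : slot_function n f ->
  is_rook_placement (placement n f).
Proof.
case=> fb fi; apply/and3P; split.
- by apply/subsetP => p; rewrite !inE => /eqP ->; case/andP: (fb _ (ltn_ord p.1)).
- apply/forallP => r; have /andP [f0 fle] := fb r (ltn_ord r).
  (* Ordinal columns are 0-based, so column number [f r] has index [(f r).-1]. *)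
  have cn : (f r).-1 < 2 * n by have := ltn_ord r; lia.
  apply/cards1P; exists (r, Ordinal cn); apply/setP => -[r' c].
  rewrite !inE xpair_eqE andbC /=; case: (eqVneq r' r) => //= ->.
  by rewrite /col_num -val_eqE /=; lia.
- apply/forallP => c; apply/card_le1_eqP => -[r1 c1] [r2 c2].
  rewrite !inE /col_num /= => /andP [/eqP e1 /eqP c1E] /andP [/eqP e2 /eqP c2E].
  congr (_, _); last by rewrite c1E c2E.
  by apply/val_inj/fi; rewrite ?ltn_ord // -e1 -e2 c1E c2E.
Qed.

Lemma rook_column_placement n f r : slot_function n f -> r < n ->
  rook_column (placement n f) r = f r.
Proof.
move=> fs rn; have [p] := rook_in_row (is_rook_placement_placement fs) rn.
by rewrite inE => /eqP pf [<- <-].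
Qed.

Lemma placement_rook_column n (R : {set cell n}) :
  is_rook_placement R -> placement n (rook_column R) = R.
Proof. by move=> RP; apply/setP => p; rewrite inE mem_rook_placement. Qed.

(** The occupied slots of the tree are the root slot 0 and the rook columns; [0 < c] excludes the
    former. *)
Lemma rook_in_column_slot n (R : R2delta n) c : 0 < c ->
  rook_in_column R c
  = (c \in unzip1 (edges 0 (tree_of (rook_column (val R)) n))).
Proof.
case: R => R RP c0; rewrite /rook_in_column /=.
have fs := slot_function_rook_column RP.
rewrite (perm_mem (perm_map fst (edges_tree_of fs))) /= inE.
rewrite (gtn_eqF c0) /= -map_comp.
apply/existsP/mapP => [[p /andP [pR /eqP <-]]|[r]].
  exists (p.1 : nat); first by rewrite mem_iota /= add0n.
  by apply/eqP; rewrite -mem_rook_placement.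
rewrite mem_iota add0n => /= rn ->.
by have [p pR [_ <-]] := rook_in_row RP rn; exists p; rewrite pR eqxx.
Qed.

Lemma rook_in_left_column_tree n (R : R2delta n) i : 0 < i ->
  rook_in_left_column R i
  = left_child_in (tree_of (rook_column (val R)) n) i.
Proof.
move=> i0; rewrite /rook_in_left_column rook_in_column_slot; last by lia.
by rewrite left_child_in_slot // (_ : (_ == 0) = false) //; lia.
Qed.

Lemma rook_in_right_column_tree n (R : R2delta n) i : 0 < i ->
  rook_in_right_column R i
  = right_child_in (tree_of (rook_column (val R)) n) i.
Proof.
move=> i0; rewrite /rook_in_right_column rook_in_column_slot; last by lia.
by rewrite right_child_in_slot // (_ : (_ == 0) = false) //; lia.
Qed.

Theorem theorem1p1 (n : nat) (hn : 1 <= n) :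
  exists Phi : R2delta n -> incr_bintree n.+1,
    bijective Phi /\
    forall (R : R2delta n) (i : nat), 1 <= i <= n ->
      [/\ (rook_in_left_column R i /\ rook_in_right_column R i
             <-> has_left_child (Phi R) i /\ has_right_child (Phi R) i),
          (~ rook_in_left_column R i /\ ~ rook_in_right_column R i
             <-> ~ has_left_child (Phi R) i /\ ~ has_right_child (Phi R) i),
          (rook_in_left_column R i /\ ~ rook_in_right_column R i
             <-> has_left_child (Phi R) i /\ ~ has_right_child (Phi R) i)
        & (rook_in_right_column R i /\ ~ rook_in_left_column R i
             <-> has_right_child (Phi R) i /\ ~ has_left_child (Phi R) i)].
Proof.
pose Phi (R : R2delta n) : incr_bintree n.+1 :=
  Sub _ (is_incr_bintree_tree_of (slot_function_rook_column (valP R))).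
pose Psi (t : incr_bintree n.+1) : R2delta n :=
  Sub _ (is_rook_placement_placement (slot_function_slot_of (valP t))).
exists Phi; split.
  exists Psi => [[R RP]|[t tP]]; apply: val_inj => /=.
    have fs := slot_function_rook_column RP.
    rewrite -[RHS](placement_rook_column RP); apply/setP => p.
    by rewrite !inE slot_of_tree_of.
  rewrite -[RHS](tree_of_slot_of tP); apply: eq_tree_of => r rn.
  exact: rook_column_placement (slot_function_slot_of tP) rn.
move=> R i /andP [i0 _].
(* Left and right columns match left and right children separately, which makes both sides of all
   four equivalences coincide. *)
by rewrite rook_in_left_column_tree // rook_in_right_column_tree.
Qed.
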